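(* Let $0<|q|<1$, $0<|p|<1$, and let $x,y$ be nonzero complex numbers. (I) Let $a,b,c,d\in\mathbb{C}$ with $p^{c}\neq p^{-n}$ and $q^{d}\ne q^{-n}$ for all integers $n\ge 0$; write $\Psi_1(x,y)=\Psi_{1}(q^{a},p^{b};p^{c},q^{d};q,p,x,y)$ and $\Psi_1^{a+}(x,y)=\Psi_{1}(q^{a+1},p^{b};p^{c},q^{d};q,p,x,y)$. If $|x|,|y|<1$, then $$(1-q^{d-1})\Psi_{1}(q^{a},p^{b};p^{c},q^{d-1};q,p,x,y)=(1-q)x\mathbb{D}_{x,q}\Psi_{1}(x,y)+(1-q^{d-1})\Psi_{1}(qx,y)\quad(\text{if }q^{d-1}\neq1),$$ $$(1-p^{c-1})\Psi_{1}(q^{a},p^{b};p^{c-1},q^{d};q,p,x,y)=(1-p)y\mathbb{D}_{y,p}\Psi_{1}(x,y)+(1-p^{c-1})\Psi_{1}(x,py)\quad(\text{if }p^{c-1}\neq1),$$ $$(1-p^{b})\Psi_{1}(q^{a},p^{b+1};p^{c},q^{d};q,p,x,y)=(1-p)y\mathbb{D}_{y,p}\Psi_{1}(x,y)+(1-p^{b})\Psi_{1}(x,py).$$ If $|x|,|xy|<1$, then $$(1-q^{a})\Psi_{1}^{a+}(x,xy)=(1-q^{a})\Psi_{1}(x,xy)+(1-q)q^{a}x\mathbb{D}_{x,q}\big[\Psi_{1}(x,xy)\big],$$ $$(1-q^{a})\Psi_{1}^{a+}(x,xy)=(1-q)x\mathbb{D}_{x,q}\big[\Psi_{1}(x,xy)\big]+(1-q^{a})\Psi_{1}(qx,qxy).$$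 If $|xy|,|y|<1$, then $$(1-q^{a})\Psi_{1}^{a+}(xy,y)=(1-q^{a})\Psi_{1}(xy,y)+(1-q)q^{a}y\mathbb{D}_{y,q}\big[\Psi_{1}(xy,y)\big],$$ $$(1-q^{a})\Psi_{1}^{a+}(xy,y)=(1-q)y\mathbb{D}_{y,q}\big[\Psi_{1}(xy,y)\big]+(1-q^{a})\Psi_{1}(qxy,qy).$$ (II) Let $a,b,c\in\mathbb{C}$ with $p^{b}\neq p^{-n}$ and $q^{c}\ne q^{-n}$ for all integers $n\ge 0$; write $\Psi_2(x,y)=\Psi_{2}(q^{a};p^{b},q^{c};q,p,x,y)$ and $\Psi_2^{a+}(x,y)=\Psi_{2}(q^{a+1};p^{b},q^{c};q,p,x,y)$. If $|x|,|y|<1$, then $$(1-q^{c-1})\Psi_{2}(q^{a};p^{b},q^{c-1};q,p,x,y)=(1-q)x\mathbb{D}_{x,q}\Psi_{2}(x,y)+(1-q^{c-1})\Psi_{2}(qx,y)\quad(\text{if }q^{c-1}\neq1),$$ $$(1-p^{b-1})\Psi_{2}(q^{a};p^{b-1},q^{c};q,p,x,y)=(1-p)y\mathbb{D}_{y,p}\Psi_{2}(x,y)+(1-p^{b-1})\Psi_{2}(x,py)\quad(\text{if }p^{b-1}\neq1).$$ If $|x|,|xy|<1$, then $$(1-q^{a})\Psi_{2}^{a+}(x,xy)=(1-q^{a})\Psi_{2}(x,xy)+(1-q)q^{a}x\mathbb{D}_{x,q}\big[\Psi_{2}(x,xy)\big],$$ $$(1-q^{a})\Psi_{2}^{a+}(x,xy)=(1-q)x\mathbb{D}_{x,q}\big[\Psi_{2}(x,xy)\big]+(1-q^{a})\Psi_{2}(qx,qxy).$$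 If $|xy|,|y|<1$, then $$(1-q^{a})\Psi_{2}^{a+}(xy,y)=(1-q^{a})\Psi_{2}(xy,y)+(1-q)q^{a}y\mathbb{D}_{y,q}\big[\Psi_{2}(xy,y)\big],$$ $$(1-q^{a})\Psi_{2}^{a+}(xy,y)=(1-q)y\mathbb{D}_{y,q}\big[\Psi_{2}(xy,y)\big]+(1-q^{a})\Psi_{2}(qxy,qy).$$
   Context: $q,p\in\mathbb{C}$ are two independent bases with $0<|q|<1$, $0<|p|<1$; logarithms of $q$ and $p$ are fixed so that $q^{a}=e^{a\log q}$, $p^{b}=e^{b\log p}$ for complex exponents. The $q$-shifted factorial is $(A;q)_{0}=1$, $(A;q)_{k}=\prod_{r=0}^{k-1}(1-Aq^{r})$ for $k\ge1$ (similarly with base $p$). The $q$-difference operator in a variable $x$ is $\mathbb{D}_{x,q}f(x)=\dfrac{f(x)-f(qx)}{(1-q)x}$, $x\ne0$ (other variables fixed); $\mathbb{D}_{y,q}$ and $\mathbb{D}_{y,p}$ are the analogues in $y$ with bases $q$ and $p$. In expressions such as $\mathbb{D}_{x,q}[\Psi_1(x,xy)]$ the operator acts on the composite function $x\mapsto\Psi_1(x,xy)$ with $y$ fixed. The bibasic Humbert functions are, for $|x|,|y|<1$ and whenever no denominator factor vanishes, $$\Psi_{1}(q^{a},p^{b};p^{c},q^{d};q,p,x,y)=\sum_{\ell,k=0}^{\infty}\frac{(q^{a};q)_{k+\ell}(p^{b};p)_{\ell}}{(p^{c};p)_{\ell}(q^{d};q)_{k}(q;q)_{k}(p;p)_{\ell}}x^{k}y^{\ell},$$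 $$\Psi_{2}(q^{a};p^{b},q^{c};q,p,x,y)=\sum_{\ell,k=0}^{\infty}\frac{(q^{a};q)_{k+\ell}}{(p^{b};p)_{\ell}(q^{c};q)_{k}(q;q)_{k}(p;p)_{\ell}}x^{k}y^{\ell}.$$ *)

(* Defs.v *)
From Stdlib Require Import Reals.
From Coquelicot Require Import Coquelicot.

Local Open Scope C_scope.

Definition Cexp (z : C) : C :=
  ((exp (Re z) * cos (Im z))%R, (exp (Re z) * sin (Im z))%R).

(* [cpow lq a] is q^a, where [lq] is the fixed logarithm of q. *)
Definition cpow (lq a : C) : C := Cexp (a * lq).

(* (A; q)_n *)
Fixpoint qpoch (A q : C) (n : nat) : C :=
  match n with
  | O => 1
  | S m => qpoch A q m * (1 - A * q ^ m)
  end.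

Definition qdiff (q : C) (f : C -> C) (x : C) : C :=
  (f x - f (q * x)) / ((1 - q) * x).

(* Convergence of a double series: the rectangular partial sums over
   0 <= l <= m.1 and 0 <= k <= m.2 converge as both bounds tend to infinity
   independently. *)
Definition is_dsum (f : nat -> nat -> C) (s : C) : Prop :=
  filterlim (fun m : nat * nat =>
               sum_n (fun l => sum_n (fun k => f l k) (snd m)) (fst m))
    (filter_prod eventually eventually) (locally s).

(* The value is meaningful only when the double series converges. The space C
   is viewed over R because that is its complete normed structure in
   Coquelicot. *)
Definition dsum (f : nat -> nat -> C) : C :=
  @iota C_R_CompleteNormedModule (is_dsum f).

Lemma is_dsum_unique (f : nat -> nat -> C) (s : C) :
  is_dsum f s -> dsum f = s.
Proof.
  intros H.
  apply (@iota_filterlim_locally R_AbsRing C_R_CompleteNormedModule _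
           (filter_prod eventually eventually) _ _ _ H).
Qed.

(* The parameters A, B, C', D are the values q^a, p^b, p^c, q^d themselves. *)
Definition Psi1 (A B C' D q p x y : C) : C :=
  dsum (fun l k =>
    (qpoch A q (k + l) * qpoch B p l)
    / (qpoch C' p l * qpoch D q k * qpoch q q k * qpoch p p l)
    * x ^ k * y ^ l).

(* The parameters A, B, C' are the values q^a, p^b, q^c themselves. *)
Definition Psi2 (A B C' q p x y : C) : C :=
  dsum (fun l k =>
    qpoch A q (k + l)
    / (qpoch B p l * qpoch C' q k * qpoch q q k * qpoch p p l)
    * x ^ k * y ^ l).

(* Main.v *)
(** Each identity is [dsum_lin] applied to a termwise relation: replacing [x] by
    [q x] multiplies the [(l, k)] term by [q^k], and
    [(1 - A) (Aq; q)_n = (A; q)_n (1 - A q^n)] absorbs the resulting factor into a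
    shifted parameter. The series converge absolutely for [|x|, |y| < 1] because
    [(A; q)_n] is bounded and, when no factor vanishes, bounded away from [0], so
    the terms are dominated by a product of geometric series. [Psi2] is [Psi1] with
    [B = 0]. *)
Require Import Defs.
From Stdlib Require Import Reals Lra Lia FunctionalExtensionality.
From Coquelicot Require Import Coquelicot.
Local Open Scope C_scope.

(** * Convergence of double series by domination *)

Lemma sum_n_diff_le (u : nat -> C) (v : nat -> R) (n m : nat) :
  (forall k, (Cmod (u k) <= v k)%R) -> (n <= m)%nat ->
  (Cmod (sum_n u m - sum_n u n) <= sum_n v m - sum_n v n)%R.
Proof.
  intros Huv Hnm.
  induction Hnm as [|m Hnm IH].
  - replace (sum_n u n - sum_n u n) with (RtoC 0) by ring.
    rewrite Cmod_0. lra.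
  - rewrite !sum_Sn.
    change (plus (sum_n u m) (u (S m))) with (sum_n u m + u (S m)).
    change (plus (sum_n v m) (v (S m))) with (sum_n v m + v (S m))%R.
    replace (sum_n u m + u (S m) - sum_n u n)
      with ((sum_n u m - sum_n u n) + u (S m)) by ring.
    eapply Rle_trans; [apply Cmod_triangle|].
    specialize (Huv (S m)). lra.
Qed.

Lemma Cmod_sum_n_le (u : nat -> C) (v : nat -> R) (n : nat) :
  (forall k, (Cmod (u k) <= v k)%R) -> (Cmod (sum_n u n) <= sum_n v n)%R.
Proof.
  intros Huv. induction n as [|n IH].
  - rewrite !sum_O. apply Huv.
  - rewrite !sum_Sn.
    eapply Rle_trans; [apply Cmod_triangle|].
    apply Rplus_le_compat; auto.
Qed.

(** The rectangle grows in two moves through the corner [(n1, m2)]: first more rows [l], then, after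
    interchanging the sums, more columns [k]. Each move is a one-index difference of partial
    sums. *)
Lemma double_sum_diff_le (u : nat -> nat -> C) (v : nat -> nat -> R)
  (n1 n2 m1 m2 : nat) :
  (forall l k, (Cmod (u l k) <= v l k)%R) -> (n1 <= m1)%nat -> (n2 <= m2)%nat ->
  (Cmod (sum_n (fun l => sum_n (u l) m2) m1 - sum_n (fun l => sum_n (u l) n2) n1)
   <= sum_n (fun l => sum_n (v l) m2) m1 - sum_n (fun l => sum_n (v l) n2) n1)%R.
Proof.
  intros Huv H1 H2.
  replace (sum_n (fun l => sum_n (u l) m2) m1 - sum_n (fun l => sum_n (u l) n2) n1)
    with ((sum_n (fun l => sum_n (u l) m2) m1 - sum_n (fun l => sum_n (u l) m2) n1)
        + (sum_n (fun l => sum_n (u l) m2) n1 - sum_n (fun l => sum_n (u l) n2) n1))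
    by ring.
  eapply Rle_trans; [apply Cmod_triangle|].
  assert (Ha := sum_n_diff_le (fun l => sum_n (u l) m2) (fun l => sum_n (v l) m2)
                  n1 m1 (fun l => Cmod_sum_n_le _ _ m2 (Huv l)) H1).
  assert (Hb := sum_n_diff_le (fun k => sum_n (fun l => u l k) n1)
                  (fun k => sum_n (fun l => v l k) n1) n2 m2
                  (fun k => Cmod_sum_n_le _ _ n1 (fun l => Huv l k)) H2).
  cbv beta in Hb.
  rewrite <- (sum_n_switch u n1 m2), <- (sum_n_switch u n1 n2),
    <- (sum_n_switch v n1 m2), <- (sum_n_switch v n1 n2) in Hb.
  simpl in Ha, Hb. lra.
Qed.

(** Cauchy criterion along the product filter. The domination of differences requires nested
    rectangles, so two arbitrary large rectangles are both compared with the fixed corner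
    [(N1, N2)], at a cost of [eps / 2] each. *)
Lemma ex_dsum_dominated (f : nat -> nat -> C) (g : nat -> nat -> R) (T : R) :
  (forall l k, (Cmod (f l k) <= g l k)%R) ->
  filterlim (fun m : nat * nat => sum_n (fun l => sum_n (g l) (snd m)) (fst m))
    (filter_prod eventually eventually) (locally T) ->
  exists s, is_dsum f s.
Proof.
  intros Hfg HT.
  apply (proj1 (@filterlim_locally_cauchy (nat * nat) C_R_CompleteNormedModule
           (filter_prod eventually eventually) _
           (fun m : nat * nat => sum_n (fun l => sum_n (fun k => f l k) (snd m)) (fst m)))).
  intros eps.
  destruct (proj2 (@filterlim_locally_cauchy (nat * nat) R_CompleteSpace
           (filter_prod eventually eventually) _ _)
           (ex_intro _ T HT) (pos_div_2 eps)) as [P [HP Hc]].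
  destruct HP as [Q R0 [N1 HQ] [N2 HR] HQR].
  exists (fun m => (N1 <= fst m)%nat /\ (N2 <= snd m)%nat). split.
  { exists (fun n => (N1 <= n)%nat) (fun n => (N2 <= n)%nat).
    - exists N1. auto.
    - exists N2. auto.
    - simpl. auto. }
  assert (Hd : forall u, (N1 <= fst u)%nat /\ (N2 <= snd u)%nat ->
    (Cmod (sum_n (fun l => sum_n (f l) (snd u)) (fst u)
           - sum_n (fun l => sum_n (f l) N2) N1) < eps / 2)%R).
  { intros [u1 u2] [Hu1 Hu2]; simpl in *.
    eapply Rle_lt_trans; [apply (double_sum_diff_le f g); auto|].
    eapply Rle_lt_trans; [apply Rle_abs|].
    apply (Hc (N1, N2) (u1, u2)); apply HQR; auto. }
  intros u v Hu Hv.
  (* Balls of [C] are coordinatewise boxes; a bound on the modulus implies membership. *)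
  apply C_NormedModule_mixin_compat1.
  apply Hd in Hu. apply Hd in Hv.
  match type of Hu with (Cmod (?a - ?s) < _)%R =>
  match type of Hv with (Cmod (?b - _) < _)%R =>
    change (Cmod (b - a) < eps)%R;
    replace (b - a) with ((b - s) + - (a - s)) by ring end end.
  eapply Rle_lt_trans; [apply Cmod_triangle|]. rewrite Cmod_opp. lra.
Qed.

(** A rectangular partial sum factors into two finite geometric sums, each depending on one
    coordinate of the index pair. *)
Lemma filterlim_geom_double_sum (M r s : R) :
  (Rabs r < 1)%R -> (Rabs s < 1)%R ->
  filterlim (fun m : nat * nat =>
      sum_n (fun l => sum_n (fun k => M * r ^ k * s ^ l)%R (snd m)) (fst m))
    (filter_prod eventually eventually) (locally (M * / (1 - r) * / (1 - s))%R).
Proof.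
  intros Hr Hs.
  apply filterlim_ext with (fun m : nat * nat =>
    (M * sum_n (fun k => r ^ k) (snd m) * sum_n (fun l => s ^ l) (fst m))%R).
  { intros [m1 m2]; simpl.
    rewrite <- (sum_n_mult_l (K := R_Ring) (M * sum_n (fun k => r ^ k) m2)%R).
    apply sum_n_ext; intros l.
    rewrite <- (sum_n_mult_l (K := R_Ring) M (fun k => r ^ k)%R).
    rewrite <- (sum_n_mult_r (K := R_Ring) (s ^ l)%R). reflexivity. }
  apply (filterlim_comp_2 (fun m : nat * nat => M * sum_n (fun k => r ^ k) (snd m))%R
           (fun m => sum_n (fun l => s ^ l)%R (fst m)) Rmult
           (G := locally (M * / (1 - r))%R) (H := locally (/ (1 - s))%R)).
  - apply (filterlim_comp _ _ _ (fun m : nat * nat => sum_n (fun k => r ^ k)%R (snd m))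
      (Rmult M) _ (locally (/ (1 - r))%R)).
    + apply (filterlim_comp _ _ _ snd (sum_n (fun k => r ^ k)%R) _ eventually).
      * apply filterlim_snd.
      * apply is_series_geom, Hr.
    + apply (filterlim_scal_r (K := R_AbsRing) (V := R_NormedModule) M).
  - apply (filterlim_comp _ _ _ fst (sum_n (fun k => s ^ k)%R) _ eventually).
    + apply filterlim_fst.
    + apply is_series_geom, Hs.
  - apply (filterlim_mult (K := R_AbsRing)).
Qed.

(** * Linearity of double sums *)

Lemma is_dsum_lin (f g : nat -> nat -> C) (s t a b : C) :
  is_dsum f s -> is_dsum g t ->
  is_dsum (fun l k => a * f l k + b * g l k) (a * s + b * t).
Proof.
  unfold is_dsum. intros Hf Hg.
  eapply filterlim_ext; cycle 1.
  - eapply (filterlim_comp_2 (G := locally (a * s)) (H := locally (b * t)) _ _ Cplus).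
    + eapply (filterlim_comp _ _ _ _ (Cmult a)); [exact Hf|].
      (* The coefficients are complex, so [C] is taken here as a normed module over itself. *)
      apply (filterlim_scal_r (K := C_AbsRing) (V := C_NormedModule) a).
    + eapply (filterlim_comp _ _ _ _ (Cmult b)); [exact Hg|].
      apply (filterlim_scal_r (K := C_AbsRing) (V := C_NormedModule) b).
    + apply (filterlim_plus (K := C_AbsRing) (V := C_NormedModule)).
  - intros [m1 m2]; simpl.
    rewrite <- !(sum_n_mult_l (K := C_Ring)).
    rewrite <- (sum_n_plus (G := C_AbelianMonoid)).
    apply sum_n_ext; intros l.
    rewrite <- !(sum_n_mult_l (K := C_Ring)).
    symmetry. apply (sum_n_plus (G := C_AbelianMonoid)).
Qed.

(** The factor [a] stays on the left because it will be [1 - q^a] or [1 - p^b], which may vanish;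
    nothing is divided by it. *)
Lemma dsum_lin (f g h : nat -> nat -> C) (a b c : C) :
  (exists s, is_dsum f s) -> (exists s, is_dsum g s) -> (exists s, is_dsum h s) ->
  (forall l k, a * f l k = b * g l k + c * h l k) ->
  a * dsum f = b * dsum g + c * dsum h.
Proof.
  intros [s Hs] [t Ht] [u Hu] H.
  (* A zero second coefficient turns the two-term rule into scaling by [a]. *)
  assert (H1 := is_dsum_lin _ _ _ _ a 0 Hs Hs).
  assert (H2 := is_dsum_lin _ _ _ _ b c Ht Hu).
  replace (fun l k => a * f l k + 0 * f l k)
    with (fun l k => b * g l k + c * h l k) in H1.
  2:{ extensionality l. extensionality k. rewrite <- H. ring. }
  rewrite (is_dsum_unique _ _ Hs), (is_dsum_unique _ _ Ht), (is_dsum_unique _ _ Hu).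
  rewrite <- (is_dsum_unique _ _ H2), (is_dsum_unique _ _ H1). ring.
Qed.

(** * Upper and lower bounds for shifted factorials *)

Lemma Cmod_1_minus_le (z : C) : (Cmod (1 - z) <= 1 + Cmod z)%R.
Proof.
  eapply Rle_trans; [apply Cmod_triangle|]. rewrite Cmod_opp, Cmod_1. lra.
Qed.

Lemma Cmod_1_minus_ge (z : C) : (1 - Cmod z <= Cmod (1 - z))%R.
Proof.
  assert (H := Cmod_triangle (1 - z) z).
  replace (1 - z + z) with (RtoC 1) in H by ring. rewrite Cmod_1 in H. lra.
Qed.

(** With [r = |q|], each factor satisfies [|1 - A q^n| <= 1 + |A| r^n <= exp (|A| r^n)]. The
    exponents add up to [K (1 - r^n)], where [K = |A| / (1 - r)] is the full geometric sum. *)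
Lemma qpoch_bounded (A q : C) :
  (Cmod q < 1)%R -> exists M, (0 < M)%R /\ forall n, (Cmod (qpoch A q n) <= M)%R.
Proof.
  intros Hq. set (r := Cmod q) in *. set (K := (Cmod A / (1 - r))%R).
  assert (Hr : (0 <= r)%R) by apply Cmod_ge_0.
  assert (HK : (0 <= K)%R).
  { apply Rmult_le_pos; [apply Cmod_ge_0|]. left. apply Rinv_0_lt_compat. lra. }
  assert (HKe : (Cmod A = K * (1 - r))%R) by (unfold K; field; lra).
  exists (exp K). split; [apply exp_pos|].
  assert (H : forall n, (Cmod (qpoch A q n) <= exp (K * (1 - r ^ n)))%R).
  { induction n as [|n IH]; simpl.
    - rewrite Cmod_1. replace (K * (1 - 1))%R with 0%R by ring. rewrite exp_0. lra.
    - rewrite Cmod_mult.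
      replace (K * (1 - r * r ^ n))%R with (K * (1 - r ^ n) + K * (1 - r) * r ^ n)%R by ring.
      rewrite exp_plus.
      apply Rmult_le_compat; try apply Cmod_ge_0; auto.
      eapply Rle_trans; [apply Cmod_1_minus_le|].
      rewrite Cmod_mult, Cmod_pow, <- HKe. fold r. apply exp_ineq1_le. }
  intros n. eapply Rle_trans; [apply H|].
  assert (Hrn : (0 <= r ^ n)%R) by (apply pow_le; auto).
  destruct (Rle_lt_or_eq_dec (K * (1 - r ^ n)) K) as [Hlt | ->].
  - assert (0 <= K * r ^ n)%R by (apply Rmult_le_pos; auto). lra.
  - left. apply exp_increasing, Hlt.
  - lra.
Qed.

(** Up to a suitable [N] there are finitely many nonzero values, hence a positive minimum [m]; the
    factors past [N] shrink the modulus by at most one half. This gives the bound [m / 2]. *)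
Lemma qpoch_bounded_below (A q : C) :
  (Cmod q < 1)%R -> (forall n, qpoch A q n <> 0) ->
  exists m, (0 < m)%R /\ forall n, (m <= Cmod (qpoch A q n))%R.
Proof.
  intros Hq Hnz. set (r := Cmod q) in *. set (K := (Cmod A / (1 - r))%R).
  assert (Hr : (0 <= r)%R) by apply Cmod_ge_0.
  assert (HK : (0 <= K)%R).
  { apply Rmult_le_pos; [apply Cmod_ge_0|]. left. apply Rinv_0_lt_compat. lra. }
  assert (HKe : (Cmod A = K * (1 - r))%R) by (unfold K; field; lra).
  assert (HN : exists N, (K * r ^ N <= 1 / 2)%R).
  { destruct (pow_lt_1_zero r) with (y := (/ (2 * (K + 1)))%R) as [N HN].
    - rewrite Rabs_pos_eq; auto.
    - apply Rinv_0_lt_compat. lra.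
    - exists N. specialize (HN N (le_n N)).
      rewrite Rabs_pos_eq in HN by (apply pow_le; auto).
      apply Rle_trans with (K * / (2 * (K + 1)))%R.
      + apply Rmult_le_compat_l; lra.
      + apply Rmult_le_reg_r with (2 * (K + 1))%R; [lra|].
        rewrite Rmult_assoc, Rinv_l by lra. lra. }
  destruct HN as [N HN].
  (* Past [N], [prod (1 - t_i) >= 1 - sum t_i >= 1/2]. *)
  assert (Htail : forall j, (Cmod (qpoch A q N) * (1 - K * r ^ N * (1 - r ^ j))
                       <= Cmod (qpoch A q (N + j)))%R).
  { induction j as [|j IH].
    - rewrite Nat.add_0_r. simpl. lra.
    - rewrite Nat.add_succ_r. simpl. rewrite Cmod_mult.
      assert (Hp : (0 < Cmod (qpoch A q N))%R) by (apply Cmod_gt_0; auto).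
      assert (Hf := Cmod_1_minus_ge (A * q ^ (N + j))).
      rewrite Cmod_mult, Cmod_pow, HKe in Hf. fold r in Hf.
      rewrite pow_add in Hf.
      assert (Hj0 : (0 <= r ^ j)%R) by (apply pow_le; auto).
      assert (Hj1 : (r ^ j <= 1)%R).
      { rewrite <- (pow1 j). apply pow_incr. lra. }
      assert (HN0 : (0 <= K * r ^ N)%R) by (apply Rmult_le_pos; auto; apply pow_le; auto).
      set (e := (K * r ^ N)%R) in *.
      set (P := Cmod (qpoch A q N)) in *.
      assert (He : (K * (1 - r) * (r ^ N * r ^ j) = e * (r ^ j - r * r ^ j))%R)
        by (unfold e; ring).
      rewrite He in Hf.
      set (t := (r ^ j)%R) in *.
      clearbody e t P.
      assert (Ht : (0 <= r * t <= t)%R) by nra.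
      (* The product of the two brackets is [1 - e (1 - r t)] plus a nonnegative cross term, which
         is dropped. The left bracket is nonnegative since [e <= 1/2]. *)
      apply Rle_trans with (P * (1 - e * (1 - t)) * (1 - e * (t - r * t)))%R.
      + rewrite Rmult_assoc. apply Rmult_le_compat_l; [lra|].
        assert (0 <= e * (1 - t) * (e * (t - r * t)))%R
          by (repeat apply Rmult_le_pos; lra).
        lra.
      + apply Rmult_le_compat; auto.
        * apply Rmult_le_pos; [lra|]. nra.
        * nra. }
  assert (Hhead : forall n0, exists m, (0 < m)%R /\
            forall n, (n <= n0)%nat -> (m <= Cmod (qpoch A q n))%R).
  { induction n0 as [|n0 [m [Hm IH]]].
    - exists (Cmod (qpoch A q 0)). split; [apply Cmod_gt_0; auto|].
      intros n Hn. replace n with 0%nat by lia. lra.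
    - exists (Rmin m (Cmod (qpoch A q (S n0)))). split.
      + apply Rmin_glb_lt; auto. apply Cmod_gt_0; auto.
      + intros n Hn. destruct (Nat.eq_dec n (S n0)) as [->|Hne].
        * apply Rmin_r.
        * eapply Rle_trans; [apply Rmin_l|]. apply IH. lia. }
  destruct (Hhead N) as [m [Hm Hle]].
  exists (m / 2)%R. split; [lra|]. intros n.
  destruct (Nat.le_gt_cases n N) as [Hn|Hn].
  - specialize (Hle n Hn). lra.
  - replace n with (N + (n - N))%nat by lia.
    eapply Rle_trans; [|apply Htail].
    specialize (Hle N (le_n N)).
    assert (0 <= r ^ (n - N))%R by (apply pow_le; auto).
    assert (0 <= K * r ^ N)%R by (apply Rmult_le_pos; auto; apply pow_le; auto).
    assert (1 / 2 <= 1 - K * r ^ N * (1 - r ^ (n - N)))%R by nra.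
    apply Rmult_le_compat; lra.
Qed.

(** * Nonvanishing and parameter shift of shifted factorials *)

Lemma qpoch_neq_0 (A q : C) :
  (forall n : nat, A * q ^ n <> 1) -> forall n, qpoch A q n <> 0.
Proof.
  intros H. induction n as [|n IH]; simpl.
  - apply C1_nz.
  - apply Cmult_neq_0; auto. intros E. apply (H n).
    replace (A * q ^ n) with (1 - (1 - A * q ^ n)) by ring. rewrite E. ring.
Qed.

Lemma qpoch_q_neq_0 (q : C) : (Cmod q < 1)%R -> forall n, qpoch q q n <> 0.
Proof.
  intros Hq. apply qpoch_neq_0. intros n E.
  assert (H : (Cmod (q * q ^ n) < 1)%R).
  { rewrite Cmod_mult, Cmod_pow. assert (H0 := Cmod_ge_0 q).
    assert (Cmod q ^ n <= 1)%R by (rewrite <- (pow1 n); apply pow_incr; lra).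
    assert (0 <= Cmod q ^ n)%R by (apply pow_le; auto). nra. }
  rewrite E, Cmod_1 in H. lra.
Qed.

(** Both sides are [(A; q)_(n+1)], with the first factor split off on the left and the last one on
    the right. *)
Lemma qpoch_shift (A q : C) (n : nat) :
  (1 - A) * qpoch (A * q) q n = qpoch A q n * (1 - A * q ^ n).
Proof.
  induction n as [|n IH]; simpl.
  - ring.
  - rewrite Cmult_assoc, IH. ring.
Qed.

(** * Reduction of [Psi2] to [Psi1], and convergence *)

Lemma qpoch_0_l (q : C) (n : nat) : qpoch 0 q n = 1.
Proof. induction n as [|n IH]; simpl; [|rewrite IH]; ring. Qed.

(** Zero is not a power [p^b]; the specialization is available because [Psi1] takes the parameter
    values rather than the exponents. *)
Lemma Psi2_Psi1 (A B D q p x y : C) : Psi2 A B D q p x y = Psi1 A 0 B D q p x y.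
Proof.
  unfold Psi1, Psi2. f_equal. extensionality l. extensionality k.
  rewrite qpoch_0_l, Cmult_1_r. reflexivity.
Qed.

Lemma ex_dsum_Psi1 (A B C' D q p x y : C) :
  (Cmod q < 1)%R -> (Cmod p < 1)%R ->
  (forall n, qpoch C' p n <> 0) -> (forall n, qpoch D q n <> 0) ->
  (Cmod x < 1)%R -> (Cmod y < 1)%R ->
  exists s, is_dsum (fun l k =>
    (qpoch A q (k + l) * qpoch B p l)
    / (qpoch C' p l * qpoch D q k * qpoch q q k * qpoch p p l)
    * x ^ k * y ^ l) s.
Proof.
  intros Hq Hp HC HD Hx Hy.
  destruct (qpoch_bounded A q Hq) as [MA [HMA HA]].
  destruct (qpoch_bounded B p Hp) as [MB [HMB HB]].
  destruct (qpoch_bounded_below C' p Hp HC) as [mC [HmC HC']].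
  destruct (qpoch_bounded_below D q Hq HD) as [mD [HmD HD']].
  assert (Hqn := qpoch_q_neq_0 q Hq). assert (Hpn := qpoch_q_neq_0 p Hp).
  destruct (qpoch_bounded_below q q Hq Hqn) as [mq [Hmq Hq']].
  destruct (qpoch_bounded_below p p Hp Hpn) as [mp [Hmp Hp']].
  eapply ex_dsum_dominated;
    (* Upper bounds of the two numerator factorials over lower bounds of the four denominator
       ones. *)
    [|apply (filterlim_geom_double_sum (MA * MB / (mC * mD * mq * mp))
               (Cmod x) (Cmod y));
      rewrite Rabs_pos_eq; auto using Cmod_ge_0].
  intros l k. unfold Cdiv. rewrite !Cmod_mult, !Cmod_pow, Cmod_inv
    by (repeat apply Cmult_neq_0; auto).
  rewrite !Cmod_mult.
  apply Rmult_le_compat_r; [apply pow_le, Cmod_ge_0|].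
  apply Rmult_le_compat_r; [apply pow_le, Cmod_ge_0|].
  apply Rmult_le_compat.
  - apply Rmult_le_pos; apply Cmod_ge_0.
  - left. apply Rinv_0_lt_compat.
    repeat apply Rmult_lt_0_compat; apply Cmod_gt_0; auto.
  - apply Rmult_le_compat; auto using Cmod_ge_0.
  - apply Rinv_le_contravar; [repeat apply Rmult_lt_0_compat; auto|].
    repeat apply Rmult_le_compat; auto; repeat apply Rmult_le_pos; lra.
Qed.

(** * Contiguous relations for [Psi1] in terms of rescaled arguments *)

(** Makes a lowered denominator parameter admissible: if [(A; q)_n] vanished, the shift identity
    would make the nonzero product [(1 - A) (Aq; q)_n] vanish. *)
Lemma qpoch_unshift_neq_0 (A q : C) :
  A <> 1 -> (forall n, qpoch (A * q) q n <> 0) -> forall n, qpoch A q n <> 0.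
Proof.
  intros HA H n E. apply (Cmult_neq_0 (1 - A) (qpoch (A * q) q n)).
  - intros E1. apply HA. replace A with (1 - (1 - A)) by ring. rewrite E1. ring.
  - apply H.
  - rewrite qpoch_shift, E. ring.
Qed.

Lemma Cmod_mult_lt_1 (q x : C) :
  (Cmod q < 1)%R -> (Cmod x < 1)%R -> (Cmod (q * x) < 1)%R.
Proof.
  intros Hq Hx. rewrite Cmod_mult.
  assert (H1 := Cmod_ge_0 q). assert (H2 := Cmod_ge_0 x). nra.
Qed.

(** The factorial in [A] has index [k + l], so the extra factor is [1 - A q^k q^l], and [q^k q^l]
    rescales both arguments at once. *)
Lemma Psi1_raise_A (A B C' D q p x y : C) :
  (Cmod q < 1)%R -> (Cmod p < 1)%R ->
  (forall n, qpoch C' p n <> 0) -> (forall n, qpoch D q n <> 0) ->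
  (Cmod x < 1)%R -> (Cmod y < 1)%R ->
  (1 - A) * Psi1 (A * q) B C' D q p x y
  = Psi1 A B C' D q p x y - A * Psi1 A B C' D q p (q * x) (q * y).
Proof.
  intros Hq Hp HC HD Hx Hy.
  replace (Psi1 A B C' D q p x y - A * Psi1 A B C' D q p (q * x) (q * y))
    with (1 * Psi1 A B C' D q p x y + (- A) * Psi1 A B C' D q p (q * x) (q * y))
    by ring.
  apply dsum_lin; try (apply ex_dsum_Psi1; auto using Cmod_mult_lt_1).
  intros l k. unfold Cdiv. rewrite !Cmult_assoc, qpoch_shift, Cpow_add_r, !Cpow_mult_l.
  ring.
Qed.

(** Here the index is [l] alone and the base is [p], so only [y] is rescaled. *)
Lemma Psi1_raise_B (A B C' D q p x y : C) :
  (Cmod q < 1)%R -> (Cmod p < 1)%R ->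
  (forall n, qpoch C' p n <> 0) -> (forall n, qpoch D q n <> 0) ->
  (Cmod x < 1)%R -> (Cmod y < 1)%R ->
  (1 - B) * Psi1 A (B * p) C' D q p x y
  = Psi1 A B C' D q p x y - B * Psi1 A B C' D q p x (p * y).
Proof.
  intros Hq Hp HC HD Hx Hy.
  replace (Psi1 A B C' D q p x y - B * Psi1 A B C' D q p x (p * y))
    with (1 * Psi1 A B C' D q p x y + (- B) * Psi1 A B C' D q p x (p * y))
    by ring.
  apply dsum_lin; try (apply ex_dsum_Psi1; auto using Cmod_mult_lt_1).
  intros l k. unfold Cdiv.
  rewrite (Cmult_comm (qpoch A q (k + l))), !Cmult_assoc, qpoch_shift, Cpow_mult_l.
  ring.
Qed.

(** Reciprocal form of the shift identity, for factorials in the denominator. *)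
Lemma qpoch_shift_inv (A q : C) (n : nat) :
  A <> 1 -> qpoch (A * q) q n <> 0 -> qpoch A q n <> 0 ->
  (1 - A) * / qpoch A q n = (1 - A * q ^ n) * / qpoch (A * q) q n.
Proof.
  intros HA H1 H2.
  replace (1 - A) with ((1 - A) * qpoch (A * q) q n * / qpoch (A * q) q n) by (field; auto).
  rewrite qpoch_shift. field. auto.
Qed.

(** [C'] is the already lowered value [p^(c-1)], so that [C' * p] stands for [p^c]. *)
Lemma Psi1_lower_C (A B C' D q p x y : C) :
  (Cmod q < 1)%R -> (Cmod p < 1)%R -> C' <> 1 ->
  (forall n, qpoch (C' * p) p n <> 0) -> (forall n, qpoch D q n <> 0) ->
  (Cmod x < 1)%R -> (Cmod y < 1)%R ->
  (1 - C') * Psi1 A B C' D q p x y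
  = Psi1 A B (C' * p) D q p x y - C' * Psi1 A B (C' * p) D q p x (p * y).
Proof.
  intros Hq Hp HC1 HC HD Hx Hy.
  assert (HC0 := qpoch_unshift_neq_0 C' p HC1 HC).
  assert (Hqn := qpoch_q_neq_0 q Hq). assert (Hpn := qpoch_q_neq_0 p Hp).
  replace (Psi1 A B (C' * p) D q p x y - C' * Psi1 A B (C' * p) D q p x (p * y))
    with (1 * Psi1 A B (C' * p) D q p x y + (- C') * Psi1 A B (C' * p) D q p x (p * y))
    by ring.
  apply dsum_lin; try (apply ex_dsum_Psi1; auto using Cmod_mult_lt_1).
  intros l k. rewrite Cpow_mult_l.
  (* The only factorial that changes is isolated, so that its reciprocal shift can be rewritten. *)
  transitivity ((1 - C') * / qpoch C' p l
    * (qpoch A q (k + l) * qpoch B p l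
       / (qpoch D q k * qpoch q q k * qpoch p p l) * x ^ k * y ^ l)).
  - field. auto.
  - rewrite qpoch_shift_inv by auto. field. auto.
Qed.

Lemma Psi1_lower_D (A B C' D q p x y : C) :
  (Cmod q < 1)%R -> (Cmod p < 1)%R -> D <> 1 ->
  (forall n, qpoch C' p n <> 0) -> (forall n, qpoch (D * q) q n <> 0) ->
  (Cmod x < 1)%R -> (Cmod y < 1)%R ->
  (1 - D) * Psi1 A B C' D q p x y
  = Psi1 A B C' (D * q) q p x y - D * Psi1 A B C' (D * q) q p (q * x) y.
Proof.
  intros Hq Hp HD1 HC HD Hx Hy.
  assert (HD0 := qpoch_unshift_neq_0 D q HD1 HD).
  assert (Hqn := qpoch_q_neq_0 q Hq). assert (Hpn := qpoch_q_neq_0 p Hp).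
  replace (Psi1 A B C' (D * q) q p x y - D * Psi1 A B C' (D * q) q p (q * x) y)
    with (1 * Psi1 A B C' (D * q) q p x y + (- D) * Psi1 A B C' (D * q) q p (q * x) y)
    by ring.
  apply dsum_lin; try (apply ex_dsum_Psi1; auto using Cmod_mult_lt_1).
  intros l k. rewrite Cpow_mult_l.
  transitivity ((1 - D) * / qpoch D q k
    * (qpoch A q (k + l) * qpoch B p l
       / (qpoch C' p l * qpoch q q k * qpoch p p l) * x ^ k * y ^ l)).
  - field. auto.
  - rewrite qpoch_shift_inv by auto. field. auto.
Qed.

(** * Clearing the denominator of the difference operator *)

Lemma qdiff_spec (q : C) (f : C -> C) (x : C) :
  (Cmod q < 1)%R -> x <> 0 -> (1 - q) * x * qdiff q f x = f x - f (q * x).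
Proof.
  intros Hq Hx. unfold qdiff. field. split; auto.
  (* [1 - q = 0] would force [|q| = 1]. *)
  intros E. apply Cmod_gt_0 in Hx. apply (Rlt_irrefl 1).
  replace q with (1 - (1 - q)) in Hq by ring. rewrite E in Hq.
  replace (1 - 0) with (RtoC 1) in Hq by ring. rewrite Cmod_1 in Hq. exact Hq.
Qed.

(** Variant for the terms in which [q^a] stands between [1 - q] and the variable. *)
Lemma qdiff_spec_scaled (q a : C) (f : C -> C) (x : C) :
  (Cmod q < 1)%R -> x <> 0 ->
  (1 - q) * a * x * qdiff q f x = a * (f x - f (q * x)).
Proof.
  intros Hq Hx. rewrite <- qdiff_spec by assumption. ring.
Qed.

(** * Complex powers with a fixed logarithm *)

Lemma Cexp_plus (z w : C) : Cexp (z + w) = Cexp z * Cexp w.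
Proof.
  unfold Cexp, Cmult, Re, Im; simpl. rewrite exp_plus, cos_plus, sin_plus.
  f_equal; ring.
Qed.

Lemma Cexp_0 : Cexp 0 = 1.
Proof.
  unfold Cexp; simpl. rewrite exp_0, cos_0, sin_0. unfold RtoC. f_equal; ring.
Qed.

Lemma cpow_plus_1 (lq q a : C) : Cexp lq = q -> cpow lq (a + 1) = cpow lq a * q.
Proof.
  intros <-. unfold cpow. rewrite <- Cexp_plus. f_equal. ring.
Qed.

Lemma cpow_minus_1 (lq q a : C) : Cexp lq = q -> cpow lq a = cpow lq (a - 1) * q.
Proof.
  intros H. rewrite <- (cpow_plus_1 lq q) by exact H. f_equal. ring.
Qed.

Lemma cpow_opp_nat (lq q : C) (n : nat) :
  Cexp lq = q -> cpow lq (- RtoC (INR n)) * q ^ n = 1.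
Proof.
  intros <-.
  replace (Cexp lq ^ n) with (Cexp (RtoC (INR n) * lq)).
  - unfold cpow. rewrite <- Cexp_plus, <- Cexp_0. f_equal. ring.
  - induction n as [|n IH].
    + simpl. rewrite <- Cexp_0. f_equal. ring.
    + rewrite S_INR, RtoC_plus, Cpow_S, <- IH, <- Cexp_plus. f_equal. ring.
Qed.

(** A vanishing factor means [q^c q^n = 1], and [q^(-n) q^n = 1] as well, so [q^c = q^(-n)], which
    is excluded. *)
Lemma qpoch_cpow_neq_0 (lq q c : C) :
  Cexp lq = q -> (forall n : nat, cpow lq c <> cpow lq (- RtoC (INR n))) ->
  forall n, qpoch (cpow lq c) q n <> 0.
Proof.
  intros Hq H. apply qpoch_neq_0. intros n E. apply (H n).
  assert (E' := cpow_opp_nat lq q n Hq).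
  transitivity (cpow lq c * (cpow lq (- RtoC (INR n)) * q ^ n)).
  - rewrite E'. ring.
  - transitivity (cpow lq (- RtoC (INR n)) * (cpow lq c * q ^ n)).
    + ring.
    + rewrite E. ring.
Qed.

(** * The difference relations for [Psi1] and [Psi2] *)

Theorem theorem2p6 (q p lq lp x y : C)
  (hq0 : (0 < Cmod q)%R) (hq1 : (Cmod q < 1)%R)
  (hp0 : (0 < Cmod p)%R) (hp1 : (Cmod p < 1)%R)
  (hlq : Cexp lq = q) (hlp : Cexp lp = p)
  (hx : x <> 0) (hy : y <> 0) :
  (forall a b c d : C,
    (forall n : nat, cpow lp c <> cpow lp (- RtoC (INR n))) ->
    (forall n : nat, cpow lq d <> cpow lq (- RtoC (INR n))) ->
    let F := Psi1 (cpow lq a) (cpow lp b) (cpow lp c) (cpow lq d) q p in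
    let Fa := Psi1 (cpow lq (a + 1)) (cpow lp b) (cpow lp c) (cpow lq d) q p in
    ((Cmod x < 1)%R -> (Cmod y < 1)%R ->
      (cpow lq (d - 1) <> 1 ->
        (1 - cpow lq (d - 1))
          * Psi1 (cpow lq a) (cpow lp b) (cpow lp c) (cpow lq (d - 1)) q p x y
        = (1 - q) * x * qdiff q (fun t => F t y) x
          + (1 - cpow lq (d - 1)) * F (q * x) y) /\
      (cpow lp (c - 1) <> 1 ->
        (1 - cpow lp (c - 1))
          * Psi1 (cpow lq a) (cpow lp b) (cpow lp (c - 1)) (cpow lq d) q p x y
        = (1 - p) * y * qdiff p (fun t => F x t) y
          + (1 - cpow lp (c - 1)) * F x (p * y)) /\
      (1 - cpow lp b)
          * Psi1 (cpow lq a) (cpow lp (b + 1)) (cpow lp c) (cpow lq d) q p x y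
        = (1 - p) * y * qdiff p (fun t => F x t) y
          + (1 - cpow lp b) * F x (p * y)) /\
    ((Cmod x < 1)%R -> (Cmod (x * y) < 1)%R ->
      (1 - cpow lq a) * Fa x (x * y)
        = (1 - cpow lq a) * F x (x * y)
          + (1 - q) * cpow lq a * x * qdiff q (fun t => F t (t * y)) x /\
      (1 - cpow lq a) * Fa x (x * y)
        = (1 - q) * x * qdiff q (fun t => F t (t * y)) x
          + (1 - cpow lq a) * F (q * x) (q * x * y)) /\
    ((Cmod (x * y) < 1)%R -> (Cmod y < 1)%R ->
      (1 - cpow lq a) * Fa (x * y) y
        = (1 - cpow lq a) * F (x * y) y
          + (1 - q) * cpow lq a * y * qdiff q (fun t => F (x * t) t) y /\
      (1 - cpow lq a) * Fa (x * y) y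
        = (1 - q) * y * qdiff q (fun t => F (x * t) t) y
          + (1 - cpow lq a) * F (q * x * y) (q * y)))
  /\
  (forall a b c : C,
    (forall n : nat, cpow lp b <> cpow lp (- RtoC (INR n))) ->
    (forall n : nat, cpow lq c <> cpow lq (- RtoC (INR n))) ->
    let F := Psi2 (cpow lq a) (cpow lp b) (cpow lq c) q p in
    let Fa := Psi2 (cpow lq (a + 1)) (cpow lp b) (cpow lq c) q p in
    ((Cmod x < 1)%R -> (Cmod y < 1)%R ->
      (cpow lq (c - 1) <> 1 ->
        (1 - cpow lq (c - 1))
          * Psi2 (cpow lq a) (cpow lp b) (cpow lq (c - 1)) q p x y
        = (1 - q) * x * qdiff q (fun t => F t y) x
          + (1 - cpow lq (c - 1)) * F (q * x) y) /\
      (cpow lp (b - 1) <> 1 ->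
        (1 - cpow lp (b - 1))
          * Psi2 (cpow lq a) (cpow lp (b - 1)) (cpow lq c) q p x y
        = (1 - p) * y * qdiff p (fun t => F x t) y
          + (1 - cpow lp (b - 1)) * F x (p * y))) /\
    ((Cmod x < 1)%R -> (Cmod (x * y) < 1)%R ->
      (1 - cpow lq a) * Fa x (x * y)
        = (1 - cpow lq a) * F x (x * y)
          + (1 - q) * cpow lq a * x * qdiff q (fun t => F t (t * y)) x /\
      (1 - cpow lq a) * Fa x (x * y)
        = (1 - q) * x * qdiff q (fun t => F t (t * y)) x
          + (1 - cpow lq a) * F (q * x) (q * x * y)) /\
    ((Cmod (x * y) < 1)%R -> (Cmod y < 1)%R ->
      (1 - cpow lq a) * Fa (x * y) y
        = (1 - cpow lq a) * F (x * y) y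
          + (1 - q) * cpow lq a * y * qdiff q (fun t => F (x * t) t) y /\
      (1 - cpow lq a) * Fa (x * y) y
        = (1 - q) * y * qdiff q (fun t => F (x * t) t) y
          + (1 - cpow lq a) * F (q * x * y) (q * y))).
Proof.
  split.
  - intros a b c d Hc Hd F Fa. subst F Fa.
    assert (Hcn := qpoch_cpow_neq_0 lp p c hlp Hc).
    assert (Hdn := qpoch_cpow_neq_0 lq q d hlq Hd).
    rewrite (cpow_plus_1 lq q a hlq), (cpow_plus_1 lp p b hlp).
    assert (Ec := cpow_minus_1 lp p c hlp). assert (Ed := cpow_minus_1 lq q d hlq).
    split; [|split]; intros H1 H2;
      (* Each difference term becomes [f x - f (q x)], or its analogue in [y] or base [p], leaving
         only values of the series. *)
      rewrite ?(qdiff_spec_scaled q), ?qdiff_spec by assumption.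
    + split; [intros Hd1|split; [intros Hc1|]].
      (* Writing [q^d] as [q^(d-1) q] makes [q^(d-1)] the lowered parameter. *)
      * rewrite Ed in Hdn |- *. rewrite Psi1_lower_D by assumption. ring.
      * rewrite Ec in Hcn |- *. rewrite Psi1_lower_C by assumption. ring.
      * rewrite Psi1_raise_B by assumption. ring.
    (* With [A = q^a], and [F'] the value at the rescaled arguments, both claims rearrange
       [F - A F']: as [(1 - A) F + A (F - F')] and as [(F - F') + (1 - A) F']. *)
    + rewrite Psi1_raise_A, (Cmult_assoc q x y) by assumption.
      split; ring.
    + rewrite Psi1_raise_A by assumption.
      replace (x * (q * y)) with (q * x * y) by ring.
      rewrite (Cmult_assoc q x y). split; ring.
  - intros a b c Hb Hc F Fa. subst F Fa.
    assert (Hbn := qpoch_cpow_neq_0 lp p b hlp Hb).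
    assert (Hcn := qpoch_cpow_neq_0 lq q c hlq Hc).
    rewrite (cpow_plus_1 lq q a hlq).
    assert (Eb := cpow_minus_1 lp p b hlp). assert (Ec := cpow_minus_1 lq q c hlq).
    split; [|split]; intros H1 H2;
      (* From here on the series are [Psi1] with second parameter [0], and the relations of the
         first half apply. *)
      rewrite ?(qdiff_spec_scaled q), ?qdiff_spec, !Psi2_Psi1 by assumption.
    + split; [intros Hc1|intros Hb1].
      * rewrite Ec in Hcn |- *. rewrite Psi1_lower_D by assumption. ring.
      * rewrite Eb in Hbn |- *. rewrite Psi1_lower_C by assumption. ring.
    + rewrite Psi1_raise_A, (Cmult_assoc q x y) by assumption.
      split; ring.
    + rewrite Psi1_raise_A by assumption.
      replace (x * (q * y)) with (q * x * y) by ring.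
      rewrite (Cmult_assoc q x y). split; ring.
Qed.
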